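(* The properties $\neg\mathrm{UN}$, $\neg\mathrm{UN}^{\to}$ and $\neg\mathrm{NFP}$ of abstract rewrite systems are not generalised first-order properties.
   Context: An ARS is a pair $(A,\to)$, $A$ non-empty, ${\to}\subseteq A\times A$; $\twoheadrightarrow$ is the reflexive transitive closure and $\leftrightarrow^*$ the reflexive transitive closure of ${\to}\cup{\leftarrow}$. An element $a$ is a normal form if there is no $b$ with $a\to b$. The ARS has UN if for all normal forms $a,b$, $a\leftrightarrow^*b$ implies $a=b$; it has $\mathrm{UN}^{\to}$ if for all normal forms $a,b$, ($\exists x$. $x\twoheadrightarrow a$ and $x\twoheadrightarrow b$) implies $a=b$; it has NFP if for all $a\in A$ and all normal forms $b$, $a\leftrightarrow^*b$ implies $a\twoheadrightarrow b$. $\neg P$ denotes the property of not having $P$. A property $P$ of ARSs is a generalised first-order property if there is a set $\Phi$ of sentences of first-order logic with equality and a single binary predicate symbol $\to$ (interpreted as the one-step relation) such that for every ARS $\mathcal{A}$, $\mathcal{A}$ has $P$ iff $\mathcal{A}\models\Phi$. *)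

(* Defs.v *)
From Stdlib Require Import Arith Relations.

Record ARS : Type := mkARS {
  carrier :> Type;
  step : relation carrier;
  carrier_nonempty : inhabited carrier
}.

Definition property := ARS -> Prop.

Definition neg (P : property) : property := fun A => ~ P A.

Definition reduces (A : ARS) : relation A := clos_refl_trans A (step A).

Definition convertible (A : ARS) : relation A :=
  clos_refl_trans A (union A (step A) (transp A (step A))).

Definition normal_form (A : ARS) (a : A) : Prop := ~ exists b : A, step A a b.

Definition UN : property := fun A =>
  forall a b : A, normal_form A a -> normal_form A b ->
    convertible A a b -> a = b.

Definition UNr : property := fun A =>
  forall a b : A, normal_form A a -> normal_form A b ->
    (exists x : A, reduces A x a /\ reduces A x b) -> a = b.

Definition NFP : property := fun A =>
  forall a b : A, normal_form A b -> convertible A a b -> reduces A a b.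

(* First-order formulas over equality and one binary predicate symbol, with
   named variables indexed by nat. *)
Inductive formula : Type :=
| FFalse : formula
| FEq : nat -> nat -> formula
| FStep : nat -> nat -> formula
| FNot : formula -> formula
| FAnd : formula -> formula -> formula
| FOr : formula -> formula -> formula
| FImp : formula -> formula -> formula
| FForall : nat -> formula -> formula
| FExists : nat -> formula -> formula.

Fixpoint free_in (v : nat) (phi : formula) : Prop :=
  match phi with
  | FFalse => False
  | FEq x y | FStep x y => v = x \/ v = y
  | FNot p => free_in v p
  | FAnd p q | FOr p q | FImp p q => free_in v p \/ free_in v q
  | FForall x p | FExists x p => v <> x /\ free_in v p
  end.

Definition sentence (phi : formula) : Prop := forall v : nat, ~ free_in v phi.

Definition update {T : Type} (e : nat -> T) (x : nat) (a : T) : nat -> T :=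
  fun y => if Nat.eqb y x then a else e y.

Fixpoint sat (A : ARS) (e : nat -> A) (phi : formula) : Prop :=
  match phi with
  | FFalse => False
  | FEq x y => e x = e y
  | FStep x y => step A (e x) (e y)
  | FNot p => ~ sat A e p
  | FAnd p q => sat A e p /\ sat A e q
  | FOr p q => sat A e p \/ sat A e q
  | FImp p q => sat A e p -> sat A e q
  | FForall x p => forall a : A, sat A (update e x a) p
  | FExists x p => exists a : A, sat A (update e x a) p
  end.

(* The choice of the assignment e is irrelevant when phi is a sentence. *)
Definition models (A : ARS) (phi : formula) : Prop :=
  forall e : nat -> A, sat A e phi.

Definition models_set (A : ARS) (Phi : formula -> Prop) : Prop :=
  forall phi : formula, Phi phi -> models A phi.

Definition generalised_first_order (P : property) : Prop :=
  exists Phi : formula -> Prop,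
    (forall phi : formula, Phi phi -> sentence phi) /\
    (forall A : ARS, P A <-> models_set A Phi).

(* Main.v *)
From Stdlib Require Import ZArith List Lia Relations.
Require Import Defs.
Import ListNotations.
Local Open Scope Z_scope.

(** Since NFP implies UN, which implies UN->, it suffices to find an ARS with NFP
    such that every sentence failing in it also fails in some ARS without UN->.
    Take two copies of the line of integers, with steps in both directions between
    neighbours except that certain marked points have no outgoing step.  If each
    line has exactly one marked point, then every point reduces to the normal form
    of its line, so NFP holds.  If instead one line has two marked points, at
    distance [n], then the points between them reduce to two distinct normal forms.
    In an Ehrenfeucht-Fraisse game with [k] rounds marked points at distance
    greater than [2 ^ k] cannot be told apart from marked points on different
    lines. *)

(** * Ehrenfeucht-Fraisse games *)

Lemma update_free_agree {T : Type} (e f : nat -> T) (x : nat) (a : T) (p : formula) :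
  (forall v, v <> x /\ free_in v p -> e v = f v) ->
  forall v, free_in v p -> update e x a v = update f x a v.
Proof.
  intros H v Hv; unfold update.
  destruct (Nat.eqb_spec v x); auto.
Qed.

Lemma sat_free_agree (A : ARS) (phi : formula) : forall e f : nat -> A,
  (forall v, free_in v phi -> e v = f v) -> sat A e phi <-> sat A f phi.
Proof.
  induction phi as [ |x y|x y|p IHp|p IHp q IHq|p IHp q IHq|p IHp q IHq
                     |x p IHp|x p IHp]; intros e f H; simpl in *.
  - tauto.
  - rewrite (H x), (H y) by auto; tauto.
  - rewrite (H x), (H y) by auto; tauto.
  - rewrite (IHp e f) by auto; tauto.
  - rewrite (IHp e f), (IHq e f) by auto; tauto.
  - rewrite (IHp e f), (IHq e f) by auto; tauto.
  - rewrite (IHp e f), (IHq e f) by auto; tauto.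
  - split; intros Hs a; apply (IHp _ _ (update_free_agree e f x a p H)), Hs.
  - split; intros [a Hs]; exists a;
      apply (IHp _ _ (update_free_agree e f x a p H)), Hs.
Qed.

Fixpoint quantifier_rank (phi : formula) : nat :=
  match phi with
  | FFalse | FEq _ _ | FStep _ _ => 0
  | FNot p => quantifier_rank p
  | FAnd p q | FOr p q | FImp p q => Nat.max (quantifier_rank p) (quantifier_rank q)
  | FForall _ p | FExists _ p => S (quantifier_rank p)
  end.

(* A position is the list of pairs of points chosen so far; [I k l] says that
   Duplicator survives [k] more rounds from position [l]. *)
Record back_and_forth (A B : ARS) (I : nat -> list (A * B) -> Prop) : Prop := {
  bf_eq : forall k l a b a' b', I k l -> In (a, b) l -> In (a', b') l ->
    (a = a' <-> b = b');
  bf_step : forall k l a b a' b', I k l -> In (a, b) l -> In (a', b') l ->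
    (step A a a' <-> step B b b');
  bf_forth : forall k l, I (S k) l -> forall a, exists b, I k ((a, b) :: l);
  bf_back : forall k l, I (S k) l -> forall b, exists a, I k ((a, b) :: l)
}.

Lemma update_in {A B : Type} (l : list (A * B)) (e : nat -> A) (f : nat -> B) x a b :
  (forall v, In (e v, f v) l) ->
  forall v, In (update e x a v, update f x b v) ((a, b) :: l).
Proof.
  intros H v; unfold update; simpl.
  destruct (Nat.eqb v x); auto.
Qed.

(** Each quantifier spends one round: the new pair extends the position and becomes the value of the
    bound variable. Assignments are total, so the position has to cover the values of all variables,
    not only of the free ones; [update_in] preserves this. *)
Lemma back_and_forth_sat (A B : ARS) (I : nat -> list (A * B) -> Prop) :
  back_and_forth A B I ->
  forall phi k l e f, (quantifier_rank phi <= k)%nat -> I k l ->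
    (forall v, In (e v, f v) l) -> sat A e phi <-> sat B f phi.
Proof.
  intros [Heq Hstep Hforth Hback].
  induction phi as [ |x y|x y|p IHp|p IHp q IHq|p IHp q IHq|p IHp q IHq
                     |x p IHp|x p IHp]; intros k l e f Hk HI Hl; simpl in *.
  - tauto.
  - eauto.
  - eauto.
  - rewrite (IHp k l e f) by (auto; lia); tauto.
  - rewrite (IHp k l e f), (IHq k l e f) by (auto; lia); tauto.
  - rewrite (IHp k l e f), (IHq k l e f) by (auto; lia); tauto.
  - rewrite (IHp k l e f), (IHq k l e f) by (auto; lia); tauto.
  - destruct k as [|k]; [lia|]. apply le_S_n in Hk.
    split; intros Hs.
    + intros b. destruct (Hback k l HI b) as [a Ha].
      apply (IHp k _ _ _ Hk Ha (update_in l e f x a b Hl)), Hs.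
    + intros a. destruct (Hforth k l HI a) as [b Hb].
      apply (IHp k _ _ _ Hk Hb (update_in l e f x a b Hl)), Hs.
  - destruct k as [|k]; [lia|]. apply le_S_n in Hk.
    split; intros [c Hs].
    + destruct (Hforth k l HI c) as [b Hb]. exists b.
      apply (IHp k _ _ _ Hk Hb (update_in l e f x c b Hl)), Hs.
    + destruct (Hback k l HI c) as [a Ha]. exists a.
      apply (IHp k _ _ _ Hk Ha (update_in l e f x a c Hl)), Hs.
Qed.

(** * Marked lines *)

Definition point : Type := (bool * Z)%type.

Definition shift (u : point) (z : Z) : point := (fst u, snd u + z).

Lemma shift_0 (u : point) : shift u 0 = u.
Proof. destruct u; unfold shift; simpl; f_equal; lia. Qed.

Lemma shift_shift (u : point) (y z : Z) : shift (shift u y) z = shift u (y + z).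
Proof. unfold shift; simpl; f_equal; lia. Qed.

Lemma shift_inj (u v : point) (z : Z) : shift u z = shift v z -> u = v.
Proof.
  destruct u, v; unfold shift; simpl; intros H; inversion H; f_equal; lia.
Qed.

Lemma shift_fixed (u : point) (z : Z) : u = shift u z <-> z = 0.
Proof.
  split.
  - destruct u; unfold shift; simpl; intros H; inversion H; lia.
  - intros ->; now rewrite shift_0.
Qed.

Definition marked_step (m : point -> Prop) : relation point :=
  fun u v => (v = shift u 1 \/ v = shift u (-1)) /\ ~ m u.

Definition marked_lines (m : point -> Prop) : ARS :=
  mkARS point (marked_step m) (inhabits (false, 0)).

(** * The game on marked lines *)

Definition match_up_to (r : Z) (l : list (point * point)) : Prop :=
  forall u v u' v', In (u, v) l -> In (u', v') l ->
  forall z, Z.abs z <= r -> (u' = shift u z <-> v' = shift v z).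

(** In [match_up_to], offset 0 settles equality and offsets 1 and -1 settle steps; larger offsets
    are kept for later rounds. The last two fields put all marks into the position, so any point
    outside it is unmarked. *)
Record lines_game (m n : point -> Prop) (r : Z) (l : list (point * point)) : Prop := {
  lg_match : match_up_to r l;
  lg_mark : forall u v, In (u, v) l -> (m u <-> n v);
  lg_mark_l : forall u, m u -> exists v, In (u, v) l;
  lg_mark_r : forall v, n v -> exists u, In (u, v) l
}.

(** Exchanging the two systems turns a move of Spoiler in the second one into a move in the first,
    so [lines_game_back] follows from [lines_game_forth]. *)
Definition swap_pairs (l : list (point * point)) : list (point * point) :=
  map (fun uv => (snd uv, fst uv)) l.

Lemma in_swap_pairs l u v : In (u, v) (swap_pairs l) <-> In (v, u) l.
Proof.
  unfold swap_pairs; rewrite in_map_iff; split.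
  - intros [[x y] [H Hin]]; simpl in H; inversion H; now subst.
  - intros H; now exists (v, u).
Qed.

Lemma swap_pairs_involutive l : swap_pairs (swap_pairs l) = l.
Proof.
  unfold swap_pairs; rewrite map_map; simpl.
  rewrite <- (map_id l) at 2; apply map_ext; now intros [].
Qed.

Lemma lines_game_swap m n r l : lines_game m n r l -> lines_game n m r (swap_pairs l).
Proof.
  intros [H1 H2 H3 H4]; split.
  - intros u v u' v' Hu Hv z Hz; rewrite in_swap_pairs in Hu, Hv.
    symmetry; now apply H1.
  - intros u v Hu; rewrite in_swap_pairs in Hu; symmetry; auto.
  - intros u Hu; destruct (H4 u Hu) as [v Hv]; exists v; now apply in_swap_pairs.
  - intros v Hv; destruct (H3 v Hv) as [u Hu]; exists u; now apply in_swap_pairs.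
Qed.

Definition near (r : Z) (u p : point) : Prop := exists z, Z.abs z <= r /\ p = shift u z.

Lemma near_dec r u p : {near r u p} + {~ near r u p}.
Proof.
  destruct u as [c x], p as [d y].
  destruct (Bool.bool_dec d c) as [->|Hd].
  - destruct (Z_le_gt_dec (Z.abs (y - x)) r) as [Hr|Hr].
    + left; exists (y - x); split; [assumption|].
      unfold shift; simpl; f_equal; lia.
    + right; intros [z [Hz H]]; unfold shift in H; simpl in H.
      inversion H; subst; lia.
  - right; intros [z [Hz H]]; unfold shift in H; simpl in H; now inversion H.
Qed.

Lemma exists_far_point (r : Z) (l : list (point * point)) :
  exists q, forall u v, In (u, v) l -> ~ near r v q.
Proof.
  assert (HN : exists N, forall u v, In (u, v) l -> snd v <= N).
  { induction l as [|[u0 v0] l [N HN]].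
    - exists 0; now simpl.
    - exists (Z.max N (snd v0)); intros u v [H|H].
      + inversion H; subst; lia.
      + specialize (HN u v H); lia. }
  destruct HN as [N HN]; exists (false, N + Z.abs r + 1).
  intros u v Hin [z [Hz H]]; specialize (HN u v Hin).
  unfold shift in H; inversion H; lia.
Qed.

Lemma match_up_to_cons r l p q : match_up_to r l ->
  (forall u v z, In (u, v) l -> Z.abs z <= r -> (p = shift u z <-> q = shift v z)) ->
  match_up_to r ((p, q) :: l).
Proof.
  intros Hm Hp u v u' v' [H|H] [H'|H'] z Hz.
  - inversion H; inversion H'; subst; now rewrite !shift_fixed.
  (* The new pair now comes first, so the relation is read backwards, with offset [- z]. *)
  - inversion H; subst u v.
    assert (E : forall a b : point, a = shift b z <-> b = shift a (- z)).
    { intros a b; split; intros ->; rewrite shift_shift;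
        [rewrite Z.add_opp_diag_r|rewrite Z.add_opp_diag_l]; now rewrite shift_0. }
    rewrite (E u' p), (E v' q); apply Hp; [assumption|lia].
  - inversion H'; subst u' v'; now apply Hp.
  - now apply Hm with (1 := H).
Qed.

Lemma match_up_to_le r s l : r <= s -> match_up_to s l -> match_up_to r l.
Proof. intros Hrs H u v u' v' Hu Hv z Hz; apply H; auto; lia. Qed.

(* A point within distance [r] of an old one is answered by the corresponding shift
   (whence the doubled radius), any other point by one far from all old ones. *)
Lemma lines_game_forth m n r l : 0 <= r -> lines_game m n (2 * r) l ->
  forall p, exists q, lines_game m n r ((p, q) :: l).
Proof.
  intros Hr [Hmatch Hmark Hl Hr'] p.
  assert (Hq : exists q,
    (forall u v z, In (u, v) l -> Z.abs z <= r -> (p = shift u z <-> q = shift v z)) /\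
    (m p <-> n q)).
  { destruct (Exists_dec (fun uv => near r (fst uv) p) l
                (fun uv => near_dec r (fst uv) p)) as [He|He].
    - apply Exists_exists in He as [[u v] [Hin [z [Hz Hp]]]]; simpl in Hp; subst p.
      exists (shift v z); split.
      + intros u' v' y Hin' Hy.
        (* Relating the new points to another old pair at offset [y] amounts to relating two old
           pairs at offset [z - y], which is at most [2 * r] in absolute value. *)
        assert (E : forall a b : point,
                   shift a z = shift b y <-> b = shift a (z - y)).
        { intros a b; replace z with (z - y + y) at 1 by lia.
          rewrite <- shift_shift; split.
          - intros H; now apply shift_inj in H.
          - now intros ->. }
        rewrite !E; apply Hmatch; auto; lia.
      + split; intros H.
        (* A marked [shift u z] is already in the position, and matching forces its partner to be
           [shift v z]. *)
        * destruct (Hl _ H) as [v' Hv'].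
          rewrite <- (proj1 (Hmatch u v _ v' Hin Hv' z ltac:(lia)) eq_refl).
          now apply (Hmark _ _ Hv').
        * destruct (Hr' _ H) as [u' Hu'].
          rewrite <- (proj2 (Hmatch u v u' _ Hin Hu' z ltac:(lia)) eq_refl).
          now apply (Hmark _ _ Hu').
    - destruct (exists_far_point r l) as [q Hq]; exists q.
      assert (Hp : forall u v, In (u, v) l -> ~ near r u p).
      { intros u v Hin Hn; apply He, Exists_exists; now exists (u, v). }
      split.
      + intros u v z Hin Hz; split; intros H; exfalso.
        * apply (Hp u v Hin); now exists z.
        * apply (Hq u v Hin); now exists z.
      (* Neither point is marked: a mark would belong to the position and be at distance 0 from
         itself. *)
      + split; intros H; exfalso.
        * destruct (Hl _ H) as [v Hv]; apply (Hp p v Hv).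
          exists 0; rewrite shift_0; split; [simpl; lia|reflexivity].
        * destruct (Hr' _ H) as [u Hu]; apply (Hq u q Hu).
          exists 0; rewrite shift_0; split; [simpl; lia|reflexivity]. }
  destruct Hq as [q [Hq Hpq]]; exists q; split.
  - apply match_up_to_cons; [|assumption].
    apply (match_up_to_le _ (2 * r)); [lia|assumption].
  - intros u v [H|H]; [inversion H; now subst|auto].
  - intros u Hu; destruct (Hl u Hu) as [v Hv]; exists v; now right.
  - intros v Hv; destruct (Hr' v Hv) as [u Hu]; exists u; now right.
Qed.

Lemma lines_game_back m n r l : 0 <= r -> lines_game m n (2 * r) l ->
  forall q, exists p, lines_game m n r ((p, q) :: l).
Proof.
  intros Hr H q.
  destruct (lines_game_forth n m r _ Hr (lines_game_swap _ _ _ _ H) q) as [p Hp].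
  exists p; apply lines_game_swap in Hp; simpl in Hp.
  fold (swap_pairs (swap_pairs l)) in Hp; now rewrite swap_pairs_involutive in Hp.
Qed.

Lemma lines_back_and_forth (m n : point -> Prop) :
  back_and_forth (marked_lines m) (marked_lines n)
    (fun k => lines_game m n (2 ^ Z.of_nat k)).
Proof.
  assert (Hpos : forall k, 0 < 2 ^ Z.of_nat k).
  { intros k; apply Z.pow_pos_nonneg; lia. }
  assert (HS : forall k, 2 ^ Z.of_nat (S k) = 2 * 2 ^ Z.of_nat k).
  { intros k; rewrite Nat2Z.inj_succ; apply Z.pow_succ_r; lia. }
  split.
  - intros k l a b a' b' HI Ha Ha'; specialize (Hpos k).
    generalize (lg_match _ _ _ _ HI a' b' a b Ha' Ha 0); rewrite !shift_0.
    intros H; apply H; simpl; lia.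
  - intros k l a b a' b' HI Ha Ha'; specialize (Hpos k); simpl; unfold marked_step.
    rewrite (lg_mark _ _ _ _ HI a b Ha).
    rewrite (lg_match _ _ _ _ HI a b a' b' Ha Ha' 1) by (simpl; lia).
    now rewrite (lg_match _ _ _ _ HI a b a' b' Ha Ha' (-1)) by (simpl; lia).
  - intros k l HI; rewrite HS in HI.
    apply lines_game_forth; [specialize (Hpos k); lia|assumption].
  - intros k l HI; rewrite HS in HI.
    apply lines_game_back; [specialize (Hpos k); lia|assumption].
Qed.

(** * The two systems *)

Definition zero_mark : point -> Prop := fun u => snd u = 0.

Definition two_marks (n : Z) : point -> Prop := fun u => u = (false, 0) \/ u = (false, n).

(** No offset of size at most [r] joins the two marks in either system: on the left they are [n]
    apart, on the right they lie on different lines. *)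
Lemma lines_game_start (r n : Z) : 0 < r -> r < n ->
  lines_game (two_marks n) zero_mark r
    [((false, 0), (false, 0)); ((false, n), (true, 0))].
Proof.
  intros Hr Hn; split.
  - intros u v u' v' [H|[H|[]]] [H'|[H'|[]]] z Hz; inversion H; inversion H'; subst;
      rewrite ?shift_fixed; try tauto;
      unfold shift; simpl; split; intros E; inversion E; lia.
  - intros u v [H|[H|[]]]; inversion H; subst; unfold two_marks, zero_mark; simpl; tauto.
  - intros u [->| ->]; eexists; simpl; eauto.
  - intros [[] z] Hv; unfold zero_mark in Hv; simpl in Hv; subst;
      eexists; simpl; eauto.
Qed.

(** Walk towards 0; every point before it is unmarked and may step. *)
Lemma zero_mark_reduces (c : bool) (k : nat) (z : Z) : Z.abs z = Z.of_nat k ->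
  reduces (marked_lines zero_mark) (c, z) (c, 0).
Proof.
  revert z; induction k as [|k IH]; intros z Hz.
  - replace z with 0 by lia; apply rt_refl.
  - assert (Hy : exists y, (y = 1 \/ y = -1) /\ Z.abs (z + y) = Z.of_nat k).
    { destruct (Z_le_gt_dec z 0); [exists 1|exists (-1)]; lia. }
    destruct Hy as [y [Hy Hzy]].
    apply rt_trans with (c, z + y); [|now apply IH].
    apply rt_step; split.
    + destruct Hy; subst y; auto.
    + unfold zero_mark; simpl; lia.
Qed.

Lemma convertible_same_line (m : point -> Prop) (u v : point) :
  convertible (marked_lines m) u v -> fst u = fst v.
Proof.
  intros H; induction H as [u v [[[->| ->] _]|[[->| ->] _]]| |]; simpl; congruence.
Qed.

Lemma zero_mark_NFP : NFP (marked_lines zero_mark).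
Proof.
  intros [c z] [d y] Hnf Hconv.
  apply convertible_same_line in Hconv; simpl in Hconv; subst d.
  destruct (Z.eq_dec y 0) as [->|Hy].
  - apply (zero_mark_reduces c (Z.abs_nat z)); lia.
  - exfalso; apply Hnf; exists (shift (c, y) 1); split; auto.
Qed.

Lemma marked_normal_form (m : point -> Prop) (u : point) :
  m u -> normal_form (marked_lines m) u.
Proof. intros Hu [v [_ Hv]]; auto. Qed.

Lemma two_marks_not_UNr (n : Z) : 1 < n -> ~ UNr (marked_lines (two_marks n)).
Proof.
  intros Hn H.
  assert (E : (false, 0) = (false, n)); [|inversion E; lia].
  apply H; [apply marked_normal_form; now left|apply marked_normal_form; now right|].
  assert (Hinner : forall z, 0 < z < n -> ~ two_marks n (false, z)).
  { intros z Hz [E|E]; inversion E; lia. }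
  (* The peak 1 lies strictly between the marks: one step left reaches 0, and walking right through
     unmarked points reaches [n]. *)
  exists (false, 1); split.
  - apply rt_step; split; [now right|apply Hinner; lia].
  - assert (Hk : forall k : nat, 1 + Z.of_nat k <= n ->
      reduces (marked_lines (two_marks n)) (false, 1) (false, 1 + Z.of_nat k)).
    { induction k as [|k IH]; intros Hle; [apply rt_refl|].
      apply rt_trans with (false, 1 + Z.of_nat k); [apply IH; lia|].
      apply rt_step; split; [|apply Hinner; lia].
      left; unfold shift; cbn [fst snd]; apply (f_equal (pair false)); lia. }
    replace n with (1 + Z.of_nat (Z.to_nat (n - 1))) at 2 by lia.
    apply Hk; lia.
Qed.

(** * Transfer of sentences and the conclusion *)

Lemma sentence_transfer (phi : formula) : sentence phi ->
  exists A, ~ UNr A /\ (models A phi -> models (marked_lines zero_mark) phi).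
Proof.
  intros Hphi; set (k := quantifier_rank phi).
  assert (Hpos : 0 < 2 ^ Z.of_nat k) by (apply Z.pow_pos_nonneg; lia).
  (* The marks must be farther apart than the initial radius for [k] rounds. *)
  set (n := 2 ^ Z.of_nat k + 1).
  assert (Hn : 2 ^ Z.of_nat k < n) by (unfold n; lia).
  exists (marked_lines (two_marks n)); split.
  - apply two_marks_not_UNr; lia.
  - intros Hmod e.
    (* A constant assignment takes its only value from the first pair of the starting position. *)
    apply (sat_free_agree (marked_lines zero_mark) phi e (fun _ => (false, 0))).
    { intros v Hv; now apply Hphi in Hv. }
    apply (back_and_forth_sat _ _ _ (lines_back_and_forth (two_marks n) zero_mark)
             phi k _ (fun _ => (false, 0)) _ (le_n _)
             (lines_game_start _ n Hpos Hn)).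
    + intros v; now left.
    + apply Hmod.
Qed.

(** NFP gives a reduction from [a] to [b], which is empty because [a] is a normal form. *)
Lemma NFP_UN (A : ARS) : NFP A -> UN A.
Proof.
  intros H a b Ha Hb Hab; apply (H a b Hb), clos_rt_rt1n in Hab.
  destruct Hab as [|c d Hc _]; [reflexivity|].
  exfalso; apply Ha; now exists c.
Qed.

Lemma reduces_convertible (A : ARS) (a b : A) : reduces A a b -> convertible A a b.
Proof.
  intros H; induction H.
  - apply rt_step; now left.
  - apply rt_refl.
  - eapply rt_trans; eassumption.
Qed.

Lemma reduces_convertible_sym (A : ARS) (a b : A) : reduces A a b -> convertible A b a.
Proof.
  intros H; induction H.
  - apply rt_step; now right.
  - apply rt_refl.
  - eapply rt_trans; eassumption.
Qed.

Lemma UN_UNr (A : ARS) : UN A -> UNr A.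
Proof.
  intros H a b Ha Hb [x [Hxa Hxb]]; apply H; auto.
  apply rt_trans with x; [now apply reduces_convertible_sym|now apply reduces_convertible].
Qed.

(** The system without UN-> may vary with the sentence, so an infinite [Phi] is handled one sentence
    at a time: each such system lacks [P] and hence satisfies all of [Phi]. *)
Lemma between_not_generalised_first_order (P : property) :
  (forall A, NFP A -> P A) -> (forall A, P A -> UNr A) ->
  ~ generalised_first_order (neg P).
Proof.
  intros Hlow Hup [Phi [Hsent HPhi]].
  apply (proj2 (HPhi (marked_lines zero_mark))); [|apply Hlow, zero_mark_NFP].
  intros phi Hin.
  destruct (sentence_transfer phi (Hsent phi Hin)) as [A [HA Htrans]].
  apply Htrans, (proj1 (HPhi A)); [|assumption].
  intros HP; now apply HA, Hup.
Qed.

Theorem theorem3p6 :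
  ~ generalised_first_order (neg UN) /\
  ~ generalised_first_order (neg UNr) /\
  ~ generalised_first_order (neg NFP).
Proof.
  repeat split; apply between_not_generalised_first_order;
    auto using NFP_UN, UN_UNr.
Qed.
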